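(* Let $Y$ be a set and let $\mathcal{L}$ be a $T_1$ sublattice of $2^Y$. Then the vertex set of $\Gamma(\mathcal{L})$ is $\mathcal{L} \setminus \{\emptyset, Y\}$. Moreover: (1) $\mathcal{L}$ is irreducible if and only if every pair of distinct vertices of $\Gamma(\mathcal{L})$ admits a path of length $2$ between them in $\Gamma(\mathcal{L})$. (2) $\mathcal{L}$ is connected if and only if every edge of $\Gamma(\mathcal{L})$ is part of a 3-cycle.
   Context: A sublattice $\mathcal{L}$ of $2^Y$ means a bounded lattice of subsets of $Y$: a collection of subsets of $Y$ containing $\emptyset$ and $Y$ and closed under finite unions and finite intersections. It is $T_1$ if $\{y\}\in\mathcal{L}$ for all $y\in Y$. It is irreducible if for all $A,B\in\mathcal{L}\setminus\{Y\}$ we have $A\cup B\neq Y$. It is connected if for all $A,B\in\mathcal{L}\setminus\{Y\}$ with $A\cap B=\emptyset$ we have $A\cup B\neq Y$. $\Gamma(\mathcal{L})$ denotes the zero-divisor graph of the semigroup $(\mathcal{L},\cap)$, whose absorbing element is $\emptyset$: its vertices are the nonempty $A\in\mathcal{L}$ such that $A\cap B=\emptyset$ for some nonempty $B\in\mathcal{L}$, and two distinct vertices $A,B$ are adjacent precisely when $A\cap B=\emptyset$. *)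

(* Defs.v *)
From mathcomp Require Import all_boot.
From mathcomp Require Import boolp classical_sets.

Set Implicit Arguments.
Unset Strict Implicit.
Unset Printing Implicit Defensive.

Local Open Scope classical_set_scope.

Section Lattices.
Variable Y : Type.
Implicit Type L : set (set Y).

Definition sublattice L : Prop :=
  [/\ L set0, L setT, setU_closed L & setI_closed L].

Definition T1_lattice L : Prop := forall y : Y, L [set y].

Definition irreducible_lattice L : Prop :=
  forall A B, (L `\ setT) A -> (L `\ setT) B -> A `|` B <> setT.

Definition connected_lattice L : Prop :=
  forall A B, (L `\ setT) A -> (L `\ setT) B ->
    A `&` B = set0 -> A `|` B <> setT.

Definition zd_vertices L : set (set Y) :=
  [set A | [/\ L A, A <> set0 &
             exists B, [/\ L B, B <> set0 & A `&` B = set0]]].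

Definition zd_adj L : rel (set Y) := fun A B =>
  `[< [/\ zd_vertices L A, zd_vertices L B, A <> B & A `&` B = set0] >].

End Lattices.

Section Graphs.
Variables (T : eqType) (e : rel T).

(* Vertices along a path are pairwise distinct, and the length of a path or
   cycle is its number of edges. *)
Definition path_between (n : nat) (x y : T) : Prop :=
  exists p : seq T, [/\ size p = n, path e x p, last x p = y & uniq (x :: p)].

(* A cycle is a sequence of distinct vertices; its edges are the pairs formed
   by a vertex and its cyclic successor, without orientation. *)
Definition edge_of_cycle (c : seq T) (x y : T) : Prop :=
  (x \in c /\ next c x = y) \/ (y \in c /\ next c y = x).

Definition edge_in_ncycle (n : nat) (x y : T) : Prop :=
  exists c : seq T, [/\ size c = n, ucycle e c & edge_of_cycle c x y].

End Graphs.

(* Main.v *)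
Require Import Defs.
From mathcomp Require Import all_boot.
From mathcomp Require Import boolp classical_sets.

Local Open Scope classical_set_scope.

(** Everything rests on one observation, [common_neighborP]: two vertices [A]
and [B] have a common neighbour if and only if they do not cover [Y]. A common
neighbour is a nonempty set lying outside [A `|` B]; conversely, a point outside
[A `|` B] gives a singleton, which the T1 hypothesis places in the lattice. The
same singletons show that each member other than the empty set and [Y] has a
nonzero annihilator, whence the description of the vertex set.

On the graph side, in a symmetric irreflexive graph a path of length 2 between
distinct vertices amounts to a common neighbour of its ends, and an edge lies on
a 3-cycle exactly when its ends have a common neighbour. So both graph
conditions say that certain pairs of vertices do not cover [Y]: all distinct
pairs in one case, the disjoint distinct pairs in the other. Irreducibility and
connectedness quantify over all proper members instead, but a covering pair of
proper members, disjoint or not, automatically consists of two distinct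
vertices ([covering_vertices]), so nothing changes. *)

Section CommonNeighbors.
Variables (T : eqType) (e : rel T).
Hypotheses (e_sym : symmetric e) (e_irr : irreflexive e).

Let adj_neq x y : e x y -> x != y.
Proof. by apply: contraTneq => ->; rewrite e_irr. Qed.

Lemma path_between2P x y :
  path_between e 2 x y <-> x != y /\ exists z, e x z /\ e z y.
Proof.
split=> [[[|z [|w [|? ?]]]] [] //= _|[xy [z [xz zy]]]].
  rewrite andbT => /andP[xz zw] <-; rewrite !inE negb_or andbT.
  by move=> /andP[/andP[_ xw] _]; split=> //; exists z.
exists [:: z; y]; split; rewrite //= ?xz ?zy // !inE negb_or xy.
by rewrite (adj_neq _ _ xz) (adj_neq _ _ zy).
Qed.

Lemma edge_in_3cycleP x y :
  edge_in_ncycle e 3 x y <-> e x y /\ exists z, e x z /\ e z y.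
Proof.
split=> [[[|a [|b [|c [|? ?]]]]] [] //= _|[xy [z [xz zy]]]].
  rewrite /ucycle /= andbT => /andP[/and3P[ab bc ca] _].
  (* Up to rotation, the oriented edge determines the third vertex. *)
  have third u v : u \in [:: a; b; c] -> next [:: a; b; c] u = v ->
      e u v /\ exists z, e u z /\ e z v.
    have neq := (negPf (adj_neq _ _ ab), negPf (adj_neq _ _ bc),
                 negPf (adj_neq _ _ ca)).
    rewrite !inE => /or3P[]/eqP-> <- /=.
    - by rewrite eqxx; split=> //; exists c; rewrite e_sym ca e_sym bc.
    - rewrite [b == a]eq_sym neq eqxx.
      by split=> //; exists a; rewrite e_sym ab e_sym ca.
    - rewrite neq [c == b]eq_sym neq eqxx.
      by split=> //; exists b; rewrite e_sym bc e_sym ab.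
  case=> [[xin /(third _ _ xin)//]|[yin /(third _ _ yin)[yx [z [yz zx]]]]].
  by rewrite e_sym; split=> //; exists z; rewrite e_sym zx e_sym yz.
exists [:: x; y; z]; split=> //; last by left; rewrite /= !inE eqxx.
rewrite /ucycle /= xy e_sym zy e_sym xz !inE negb_or.
by rewrite (adj_neq _ _ xy) (adj_neq _ _ xz) eq_sym (adj_neq _ _ zy).
Qed.

End CommonNeighbors.

Section T1Lattices.
Variables (Y : Type) (L : set (set Y)).
Implicit Types A B C : set Y.

Lemma zd_adjP A B :
  reflect [/\ zd_vertices L A, zd_vertices L B, A <> B & A `&` B = set0]
          (zd_adj L A B).
Proof. exact: asboolP. Qed.

Lemma zd_adj_sym : symmetric (zd_adj L).
Proof.
by move=> A B; apply/zd_adjP/zd_adjP=> -[vA vB /nesym AB AB0]; split;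
  rewrite // setIC.
Qed.

Lemma zd_adj_irr : irreflexive (zd_adj L).
Proof. by move=> A; apply/negP=> /zd_adjP[]. Qed.

(** A set disjoint from a vertex is distinct from it because vertices are
nonempty, and that vertex is itself a witness of zero divisibility. *)
Lemma disjoint_zd_adj A B :
  zd_vertices L A -> L B -> B <> set0 -> A `&` B = set0 -> zd_adj L A B.
Proof.
move=> vA LB B0 AB0; have [LA A0 _] := vA; apply/zd_adjP; split=> //.
  by split=> //; exists A; rewrite setIC.
by move=> AB; apply: A0; rewrite -[A]setIid {2}AB.
Qed.

Hypothesis L_T1 : T1_lattice L.

Lemma zd_verticesE : zd_vertices L = L `\` [set set0; setT].
Proof.
apply/seteqP; split=> A.
  move=> [LA A0 [B [_ B0 AB0]]]; split=> // -[//|AT].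
  by apply: B0; rewrite -AB0 AT setTI.
move=> [LA /not_orP[A0 AT]]; split=> //.
have /setTPn[y Ay] : A != setT by apply/eqP.
exists [set y]; split; first exact: L_T1.
  by apply/eqP/set0P; exists y.
by rewrite -subset0 => z [Az zy]; apply: Ay; rewrite -zy.
Qed.

Lemma common_neighborP A B : zd_vertices L A -> zd_vertices L B ->
  (exists C, zd_adj L A C /\ zd_adj L C B) <-> A `|` B <> setT.
Proof.
move=> vA vB; split=> [[C [/zd_adjP[_ [_ C0 _] _ AC]]]|ABT].
  move=> /zd_adjP[_ _ _ CB] ABT; apply: C0.
  by rewrite -[C]setIT -ABT setIUr CB setIC AC setU0.
have /setTPn[y yAB] : A `|` B != setT by apply/eqP.
have y0 : [set y] <> set0 by apply/eqP/set0P; exists y.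
exists [set y]; rewrite (zd_adj_sym [set y]).
by split; apply: disjoint_zd_adj => //; rewrite -subset0 => z [Dz zy];
  apply: yAB; rewrite -zy; [left|right].
Qed.

Lemma covering_vertices A B : (L `\ setT) A -> (L `\ setT) B ->
  A `|` B = setT -> [/\ zd_vertices L A, zd_vertices L B & A <> B].
Proof.
rewrite zd_verticesE => -[LA AT] [LB BT] ABT; split.
- by split=> // -[A0|//]; apply: BT; rewrite /= -ABT A0 set0U.
- by split=> // -[B0|//]; apply: AT; rewrite /= -ABT B0 setU0.
- by move=> AB; apply: AT; rewrite /= -ABT AB setUid.
Qed.

Lemma zd_vertices_proper A : zd_vertices L A -> (L `\ setT) A.
Proof. by rewrite zd_verticesE => -[LA /not_orP[_ AT]]. Qed.

Lemma irreducible_pathsP : irreducible_lattice L <->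
  forall A B, zd_vertices L A -> zd_vertices L B -> A <> B ->
    path_between (zd_adj L) 2 A B.
Proof.
split=> [irrL A B vA vB AB|paths A B pA pB ABT].
  apply/(path_between2P _ _ zd_adj_irr); split; first exact/eqP.
  by apply/common_neighborP => //; apply: irrL; apply: zd_vertices_proper.
have [vA vB AB] := covering_vertices _ _ pA pB ABT.
have /(path_between2P _ _ zd_adj_irr)[_] := paths _ _ vA vB AB.
by move/(common_neighborP _ _ vA vB).
Qed.

Lemma connected_3cyclesP : connected_lattice L <->
  forall A B, zd_adj L A B -> edge_in_ncycle (zd_adj L) 3 A B.
Proof.
have cycleP := edge_in_3cycleP _ _ zd_adj_sym zd_adj_irr.
split=> [conL A B adjAB|cycles A B pA pB AB0 ABT].
  have /zd_adjP[vA vB _ AB0] := adjAB.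
  apply/cycleP; split=> //; apply/common_neighborP => //.
  by apply: conL => //; apply: zd_vertices_proper.
have [vA vB AB] := covering_vertices _ _ pA pB ABT.
have /cycles/cycleP[_] : zd_adj L A B by apply/zd_adjP.
by move/(common_neighborP _ _ vA vB).
Qed.

End T1Lattices.

Theorem proposition5p1 (Y : Type) (L : set (set Y))
    (hL : sublattice L) (hT1 : T1_lattice L) :
  zd_vertices L = L `\` [set set0; setT] /\
  (irreducible_lattice L <->
     forall A B : set Y, zd_vertices L A -> zd_vertices L B -> A <> B ->
       path_between (zd_adj L) 2 A B) /\
  (connected_lattice L <->
     forall A B : set Y, zd_adj L A B -> edge_in_ncycle (zd_adj L) 3 A B).
Proof.
split; first exact: zd_verticesE.
by split; [apply: irreducible_pathsP | apply: connected_3cyclesP].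
Qed.
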